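(* Let $(X(t))_{t=0,1,\dots}$ be a discrete-time reversible Markov chain on a finite state space $\Omega$, with transition probabilities $p(\cdot,\cdot)$ and invariant measure $\pi$, and write $\mathbb{P}^x$ for its law when started at $x$. Let $G\subset\Omega$ and assume that, for some $T>0$ and some $\alpha>0$, for every initial condition $x\in\Omega$, $\mathbb{P}^x(X(T)\in G)\ge\alpha$. Assume further that for every $\eta,\eta'$ in $G$ there exists a path $\tilde\gamma(\eta,\eta')$ from $\eta$ to $\eta'$ which stays in $G$, and let $$W(G):=\max_{\substack{a,b\in G\\ Q(a,b)\neq0}}\ \frac1{Q(a,b)}\sum_{\substack{\eta,\eta'\in G:\\ (a,b)\in\tilde\gamma(\eta,\eta')}}|\tilde\gamma(\eta,\eta')|\,\pi(\eta)\pi(\eta').$$ Then $$\mathtt{gap}^{-1}\le\frac6\alpha\Big(\frac{T^2}{p_{\min}}+\frac{W(G)}{\alpha}\Big),$$ with $p_{\min}:=\min\{p(\sigma,\sigma')>0:\ \sigma,\sigma'\in\Omega\}$.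
   Context: $Q(a,b)=\pi(a)p(a,b)=Q(b,a)$. A path from $c$ to $d$ is a sequence $\gamma(c,d)=(x_1,\dots,x_n)$ in $\Omega$ with $x_1=c$, $x_n=d$ and $p(x_i,x_{i+1})\ne0$ for all $i$; its length is $|\gamma(c,d)|:=n$; it stays in $G$ if all $x_i\in G$. One writes $(a,b)\in\gamma$ if $a=x_i$, $b=x_{i+1}$ for some $i$. One path $\tilde\gamma(\eta,\eta')$ is fixed for each pair $(\eta,\eta')\in G^2$. $T$ is an integer time. The spectral gap is $$\mathtt{gap}=\inf_f\frac{\pi\big(f(I-P)f\big)}{\operatorname{Var}_\pi(f)},$$ where $P$ is the transition kernel, $I$ the identity, $\pi(g)=\sum_x\pi(x)g(x)$, and the infimum is over functions $f:\Omega\to\mathbb{R}$ which are nonconstant (i.e. $\operatorname{Var}_\pi(f)\ne0$). *)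

(* Defs.v *)
From HB Require Import structures.
From mathcomp Require Import all_boot all_order all_algebra.
From mathcomp Require Import all_classical all_reals all_analysis.

Set Implicit Arguments.
Unset Strict Implicit.
Unset Printing Implicit Defensive.

Import Order.TTheory GRing.Theory Num.Theory.

Local Open Scope classical_set_scope.
Local Open Scope ring_scope.

Section FiniteChain.
Context {R : realType} {Omega : finType}.
Implicit Types (p : Omega -> Omega -> R) (pi f : Omega -> R).
Implicit Types (a b x y : Omega) (G : {set Omega}).

Definition stochastic p : Prop :=
  (forall x y, 0 <= p x y) /\ (forall x, \sum_y p x y = 1).

Definition distribution_on pi : Prop :=
  (forall x, 0 <= pi x) /\ \sum_x pi x = 1.

Definition invariant_measure pi p : Prop :=
  forall y, \sum_x pi x * p x y = pi y.

Definition Q pi p a b : R := pi a * p a b.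

Definition reversible pi p : Prop := forall a b, Q pi p a b = Q pi p b a.

Definition mean pi f : R := \sum_x pi x * f x.

Definition Var pi f : R := mean pi (fun x => (f x - mean pi f) ^+ 2).

Definition transition_op p f : Omega -> R := fun x => \sum_y p x y * f y.

Definition dirichlet_form pi p f : R :=
  mean pi (fun x => f x * (f x - transition_op p f x)).

(* Extended-real valued, so that with the conventions 0^-1 = +oo and
   +oo^-1 = 0 of [inve], an upper bound on [(gap pi p)^-1] does rule out a
   vanishing gap; the infimum is +oo if every f has zero variance. *)
Definition gap pi p : \bar R :=
  ereal_inf [set (dirichlet_form pi p f / Var pi f)%:E
            | f in [set f : Omega -> R | Var pi f != 0]].

(* For a stochastic p, some entry is positive and all entries are at most 1,
   so the default value 1 does not affect the minimum. *)
Definition p_min p : R :=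
  \big[Num.min/1]_(sigma : Omega)
    \big[Num.min/1]_(sigma' | 0 < p sigma sigma') p sigma sigma'.

(* The sequence of all vertices, endpoints included: its length is [size g]. *)
Definition is_path p c d (g : seq Omega) : Prop :=
  if g is x :: g' then
    [/\ x = c, last x g' = d & path (fun a b => p a b != 0) x g']
  else False.

Definition stays_in G (g : seq Omega) : Prop := {subset g <= G}.

Definition edge_in a b (g : seq Omega) : bool := (a, b) \in zip g (behead g).

(* All the terms are nonnegative, and the maximum over an empty set of pairs
   (a, b) is 0. *)
Definition W pi p (gam : Omega -> Omega -> seq Omega) G : R :=
  \big[Num.max/0]_(a in G) \big[Num.max/0]_(b in G | Q pi p a b != 0)
    ((Q pi p a b)^-1 *
     \sum_(eta in G) \sum_(eta' in G | edge_in a b (gam eta eta'))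
        (size (gam eta eta'))%:R * pi eta * pi eta').

Definition history {S : Type} (X : nat -> S -> Omega) (h : nat -> Omega)
  (n : nat) : set S := [set s | forall k, (k <= n)%N -> X k s = h k].

(* [Pr x] is the law of the chain started at x.  The last clause is the Markov
   property with transition probabilities p, multiplied out so as not to
   condition on null events. *)
Definition markov_chain {d : measure_display} {S : measurableType d} p
    (Pr : Omega -> probability S R) (X : nat -> S -> Omega) : Prop :=
  [/\ forall t y, measurable (X t @^-1` [set y]),
      forall x, Pr x (X 0%N @^-1` [set x]) = 1%E
    & forall x h n, Pr x (history X h n.+1) =
        (Pr x (history X h n) * (p (h n) (h n.+1))%:E)%E].

End FiniteChain.

(* Main.v *)
Require Import Defs.
From HB Require Import structures.
From mathcomp Require Import all_boot all_order all_algebra.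
From mathcomp Require Import all_classical all_reals all_analysis.
From mathcomp Require Import ring lra.

Set Implicit Arguments.
Unset Strict Implicit.
Unset Printing Implicit Defensive.

Import Order.TTheory GRing.Theory Num.Theory.

Local Open Scope classical_set_scope.
Local Open Scope ring_scope.

(** The variance is at most [C] times the Dirichlet form [D(f)] for the constant
    [C] of the theorem, and this is what the bound on the inverse gap says
    ([gap_inv_le]).

    A global variance is compared with a variance on [G] by letting the chain run
    for [T] steps.  Starting from [pi] and conditioning the state at time [T] to
    lie in [G], separately for each starting point, couples [pi] with a
    probability [mu] carried by [G].  Every conditioning event has probability at
    least [alpha], so [mu <= pi / alpha], and each transition of the conditioned
    kernel is at most [1 / alpha] times the original one.  Let [c] be the
    [mu]-mean of [f] and [(x, y)] a coupled pair.  Then [Var pi f] is at most the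
    mean of [(f x - c)^2], hence at most
      [2 E (f x - f y)^2 + 2 Var mu f]    ([Var_le_displacement_add_local]).

    The first mean is at most [1 / alpha] times the mean square of
    [f(X_0) - f(X_T)] for the stationary chain; a sum of [T] increments, each of
    mean square [2 D(f)], has mean square at most [T^2 * 2 D(f)]
    ([mean_sqr_displacement]).  The second, written as a sum over pairs of
    points of [G], is at most [1 / alpha^2] times the same sum weighted by
    [pi pi], which the canonical paths inside [G] bound by [W * 2 D(f)]
    ([canonical_paths_bound]).  Together
      [Var pi f <= (4 T^2 / alpha + 2 W / alpha^2) D(f)],
    and [p_min <= 1] gives the stated constant.

    The hypothesis on [G] concerns the law of a process; [law_of_set] identifies
    that law with the iterates of the transition matrix. *)

(** * Quadratic forms as sums over pairs of states *)

Section QuadraticForms.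
Context {R : realType} {Omega : finType}.
Implicit Types (pi f : Omega -> R) (p : Omega -> Omega -> R).

Lemma mean_sqr_centered pi f (c : R) : distribution_on pi ->
  mean pi (fun x => (f x - c) ^+ 2) =
  mean pi (fun x => f x ^+ 2) - c * (2 * mean pi f) + c ^+ 2.
Proof.
move=> [_ pi1]; rewrite /mean.
have -> : c ^+ 2 = \sum_x pi x * c ^+ 2 by rewrite -mulr_suml pi1 mul1r.
rewrite !mulr_sumr -sumrB -big_split /=.
by apply: eq_bigr => x _; ring.
Qed.

Lemma Var_le_mean_sqr pi f (c : R) : distribution_on pi ->
  Var pi f <= mean pi (fun x => (f x - c) ^+ 2).
Proof.
move=> pi_distr; rewrite /Var !mean_sqr_centered //; set m := mean pi f.
rewrite -subr_ge0 [leRHS](_ : _ = (m - c) ^+ 2); last by ring.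
exact: sqr_ge0.
Qed.

Lemma Var_pairs pi f : distribution_on pi ->
  2 * Var pi f = \sum_x \sum_y pi x * pi y * (f x - f y) ^+ 2.
Proof.
move=> pi_distr; rewrite /Var mean_sqr_centered //; set m := mean pi f.
have inner x : \sum_y pi x * pi y * (f x - f y) ^+ 2 =
    pi x * (mean pi (fun y => f y ^+ 2) - f x * (2 * m) + f x ^+ 2).
  rewrite -mean_sqr_centered // mulr_sumr; apply: eq_bigr => y _; ring.
under eq_bigr do rewrite inner.
have -> : \sum_x pi x * (mean pi (fun y => f y ^+ 2) - f x * (2 * m)
      + f x ^+ 2) =
    (\sum_x pi x) * mean pi (fun y => f y ^+ 2) - m * (2 * m) +
    mean pi (fun y => f y ^+ 2).
  have -> : m * (2 * m) = \sum_x pi x * f x * (2 * m) by rewrite -mulr_suml.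
  rewrite [X in _ = _ + X]/mean mulr_suml -sumrB -big_split /=.
  by apply: eq_bigr => x _; ring.
by rewrite pi_distr.2; ring.
Qed.

(** In the expanded square, the terms [f x ^+ 2] and [f y ^+ 2] both sum to
    [mean pi (f ^+ 2)]: the former because the rows of [p] sum to one, the latter
    by invariance. *)
Lemma dirichlet_pairs pi p f : stochastic p -> invariant_measure pi p ->
  2 * dirichlet_form pi p f = \sum_x \sum_y Q pi p x y * (f x - f y) ^+ 2.
Proof.
move=> [_ p1] pi_inv.
have fst : \sum_x \sum_y Q pi p x y * f x ^+ 2 = \sum_x pi x * f x ^+ 2.
  apply: eq_bigr => x _; rewrite -mulr_suml; congr (_ * _).
  by rewrite /Q -mulr_sumr p1 mulr1.
have snd : \sum_x \sum_y Q pi p x y * f y ^+ 2 = \sum_x pi x * f x ^+ 2.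
  rewrite exchange_big; apply: eq_bigr => y _ /=.
  by rewrite -mulr_suml; congr (_ * _); exact: pi_inv.
have -> : 2 * dirichlet_form pi p f = \sum_x pi x * f x ^+ 2
    + \sum_x pi x * f x ^+ 2 - 2 * \sum_x \sum_y Q pi p x y * (f x * f y).
  rewrite /dirichlet_form /mean !mulr_sumr -big_split -sumrB /=.
  apply: eq_bigr => x _; rewrite /transition_op.
  have -> : \sum_y Q pi p x y * (f x * f y) = pi x * f x * \sum_y p x y * f y.
    by rewrite mulr_sumr; apply: eq_bigr => y _; rewrite /Q; ring.
  ring.
rewrite -{1}fst -snd mulr_sumr -big_split -sumrB /=.
apply: eq_bigr => x _; rewrite mulr_sumr -big_split -sumrB /=.
by apply: eq_bigr => y _; ring.
Qed.

End QuadraticForms.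

(** * Displacement of the stationary chain over several steps *)

Section SeveralSteps.
Context {R : realType} {Omega : finType}.
Implicit Types (pi f : Omega -> R) (p : Omega -> Omega -> R).

Fixpoint transition_iter p n : Omega -> Omega -> R :=
  if n is m.+1 then fun x y => \sum_z p x z * transition_iter p m z y
  else fun x y => (x == y)%:R.

Lemma sum_delta (x : Omega) (F : Omega -> R) :
  \sum_y (x == y)%:R * F y = F x.
Proof.
rewrite (bigD1 x) //= eqxx mul1r big1 ?addr0 // => y.
by rewrite eq_sym => /negPf ->; rewrite mul0r.
Qed.

Lemma stochastic_iter p n : stochastic p -> stochastic (transition_iter p n).
Proof.
move=> [p0 p1]; elim: n => [|n [IH0 IH1]]; split=> x /=.
- by move=> y; rewrite ler0n.
- by rewrite -[RHS](sum_delta x (fun=> 1)); apply: eq_bigr => y _; rewrite mulr1.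
- by move=> y; apply: sumr_ge0 => z _; rewrite mulr_ge0.
- rewrite exchange_big -[RHS](p1 x); apply: eq_bigr => z _ /=.
  by rewrite -mulr_sumr IH1 mulr1.
Qed.

Lemma invariant_iter pi p n :
  invariant_measure pi p -> invariant_measure pi (transition_iter p n).
Proof.
move=> pi_inv; elim: n => [|n IH] y /=.
  rewrite -[RHS](sum_delta y); apply: eq_bigr => x _.
  by rewrite eq_sym mulrC.
under eq_bigr do rewrite mulr_sumr; rewrite exchange_big /= -[RHS]IH.
apply: eq_bigr => z _; rewrite -pi_inv mulr_suml.
by apply: eq_bigr => x _; rewrite mulrA.
Qed.

(** The discrete analogue of [|f(X_0) - f(X_n)|^2 <= n sum |increments|^2]:
    in stationarity every one of the [n] increments has the same mean square,
    twice the Dirichlet form. *)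
Lemma mean_sqr_displacement pi p f n : distribution_on pi -> stochastic p ->
    invariant_measure pi p ->
  \sum_x \sum_y pi x * transition_iter p n x y * (f x - f y) ^+ 2 <=
  n%:R ^+ 2 * (2 * dirichlet_form pi p f).
Proof.
move=> [pi0 _] hp pi_inv; rewrite dirichlet_pairs //; have [p0 p1] := hp.
set A1 := \sum_x \sum_y Q pi p x y * _.
elim: n => [|n IH].
  rewrite expr0n mul0r big1 // => x _; rewrite big1 // => y _ /=.
  by case: eqP => [->|_]; rewrite ?subrr ?expr0n ?mulr0 ?mul0r.
have [q0 q1] := stochastic_iter n hp.
case: n => [|n] in IH q0 q1 *.
  rewrite expr1n mul1r /A1; apply: ler_sum => x _; apply: ler_sum => y _ /=.
  rewrite /Q; under eq_bigr do rewrite mulrC eq_sym.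
  by rewrite sum_delta.
set m := n.+1 in IH q0 q1 *; set q := transition_iter p m in IH q0 q1 *.
have m_gt0 : 0 < m%:R :> R by rewrite ltr0n.
rewrite -(ler_pM2l m_gt0).
(* Split the displacement at time one; the weights [m (m+1)] and [m+1] are
   those of the convexity inequality for a mean of [m+1] numbers. *)
have bound : m%:R * (\sum_x \sum_y pi x * (\sum_z p x z * q z y)
       * (f x - f y) ^+ 2) <=
     m%:R * (m%:R + 1) * A1 + (m%:R + 1) *
       \sum_x \sum_y pi x * q x y * (f x - f y) ^+ 2.
  have -> : A1 = \sum_x \sum_y \sum_z pi x * p x z * q z y * (f x - f z) ^+ 2.
    apply: eq_bigr => x _; rewrite exchange_big; apply: eq_bigr => z _ /=.
    by rewrite -mulr_suml -mulr_sumr q1 mulr1.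
  have -> : \sum_x \sum_y pi x * q x y * (f x - f y) ^+ 2 =
      \sum_x \sum_y \sum_z pi x * p x z * q z y * (f z - f y) ^+ 2.
    rewrite exchange_big [RHS]exchange_big /=; apply: eq_bigr => y _.
    rewrite [RHS]exchange_big /=; apply: eq_bigr => z _.
    by rewrite -pi_inv !mulr_suml.
  rewrite !mulr_sumr -big_split /=; apply: ler_sum => x _.
  rewrite !mulr_sumr -big_split /=; apply: ler_sum => y _.
  rewrite mulr_sumr mulr_suml !mulr_sumr -big_split /=; apply: ler_sum => z _.
  set w := _ * q z y; have w0 : 0 <= pi x * w by rewrite !mulr_ge0.
  rewrite -subr_ge0 [leRHS](_ : _ =
    pi x * w * (m%:R * (f x - f z) - (f z - f y)) ^+ 2); last first.
    by rewrite /w; ring.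
  by rewrite mulr_ge0 ?sqr_ge0.
apply: (le_trans bound); move: IH m_gt0; rewrite -(natr1 m).
move: (\sum_x _) => A IH m_gt0.
have : (m%:R + 1) * A <= (m%:R + 1) * (m%:R ^+ 2 * A1).
  by rewrite ler_wpM2l // addr_ge0 // ltW.
move=> le_A; apply: (le_trans (lerD (lexx _) le_A)).
by rewrite le_eqVlt; apply/orP; left; apply/eqP; ring.
Qed.

End SeveralSteps.

(** * Canonical paths *)

Section CanonicalPaths.
Context {R : realType} {Omega : finType}.
Implicit Types (pi f : Omega -> R) (p : Omega -> Omega -> R).

Lemma sqr_sum_le_size (I : Type) (r : seq I) (F : I -> R) :
  (\sum_(i <- r) F i) ^+ 2 <= (size r)%:R * \sum_(i <- r) F i ^+ 2.
Proof.
elim: r => [|i r IH]; first by rewrite !big_nil expr0n mulr0.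
rewrite !big_cons /= -natr1.
set s := \sum_(j <- r) F j in IH *; set V := \sum_(j <- r) _ in IH *.
case: r @s @V IH => [|j r] s V IH; first by rewrite /s /V !big_nil !addr0 add0r mul1r.
set n := (size _)%:R in IH *; have n_gt0 : 0 < n by rewrite ltr0n.
rewrite -(ler_pM2l n_gt0).
have := sqr_ge0 (n * F i - s); nra.
Qed.

Lemma path_all_zip (e : rel Omega) x s :
  path e x s = all (fun ab => e ab.1 ab.2) (zip (x :: s) s).
Proof. by elim: s x => //= y s IH x; rewrite IH. Qed.

Lemma telescope_path f x s :
  f x - f (last x s) = \sum_(ab <- zip (x :: s) s) (f ab.1 - f ab.2).
Proof.
elim: s x => [|y s IH] x; first by rewrite big_nil subrr.
by rewrite /= big_cons -IH /=; ring.
Qed.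

Lemma mem_zip (I J : eqType) (s : seq I) (t : seq J) a b :
  (a, b) \in zip s t -> a \in s /\ b \in t.
Proof.
elim: s t => [|x s IH] [|y t] //=; rewrite !inE => /orP[/eqP[-> ->]|].
  by rewrite !eqxx.
by case/IH => -> ->; rewrite !orbT.
Qed.

(** A path that runs through the same edge several times would spoil the
    Cauchy-Schwarz bound, in which every edge is counted once.  Erasing the
    loops, inside the graph [e] of the allowed edges, gives a path with distinct
    edges that is no longer and still uses only edges of [e]. *)
Lemma sqr_increment_path (e : rel Omega) f x s : path e x s ->
  (f x - f (last x s)) ^+ 2 <=
  (size (x :: s))%:R * \sum_a \sum_(b | e a b) (f a - f b) ^+ 2.
Proof.
case/shortenP => s' path_s' /= /andP[_ uniq_s'] sub_s'.
rewrite telescope_path; apply: (le_trans (sqr_sum_le_size _ _)).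
apply: ler_pM => //.
- by apply: sumr_ge0 => ab _; exact: sqr_ge0.
- rewrite ler_nat size_zip; apply: (leq_trans (geq_minr _ _)).
  exact: leqW (uniq_leq_size uniq_s' sub_s').
rewrite big_uniq ?zip_uniqr //= pair_big_dep /=.
rewrite [leLHS]big_mkcond [leRHS]big_mkcond; apply: ler_sum => ab _.
case: ifP => [ab_s'|_]; last by case: ifP => // _; exact: sqr_ge0.
by move: path_s'; rewrite path_all_zip => /allP ->.
Qed.

(** From a state of positive mass, reversibility makes every state reached
    through possible transitions have positive mass. *)
Lemma path_Q_neq0 pi p x s : reversible pi p -> pi x != 0 ->
  path (fun a b => p a b != 0) x s -> path (fun a b => Q pi p a b != 0) x s.
Proof.
move=> pi_rev; elim: s x => //= y s IH x pix /andP[pxy path_s].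
have Qxy : Q pi p x y != 0 by rewrite mulf_neq0.
rewrite Qxy IH //; apply: contra Qxy => /eqP piy.
by rewrite pi_rev /Q piy mul0r.
Qed.

Lemma edge_weight_le_W pi p gam (G : {set Omega}) a b :
    a \in G -> b \in G -> 0 < Q pi p a b ->
  \sum_(eta in G) \sum_(eta' in G | edge_in a b (gam eta eta'))
     (size (gam eta eta'))%:R * pi eta * pi eta' <= W pi p gam G * Q pi p a b.
Proof.
move=> aG bG Qab; rewrite -ler_pdivrMr // mulrC.
apply: (bigmax_sup a) => //; apply: (bigmax_sup b) => //.
by rewrite bG gt_eqF.
Qed.

(** Cauchy-Schwarz along each path bounds a difference by the increments on its
    edges; collecting the contributions edge by edge, the edge [(a, b)] receives
    exactly the sum whose ratio to [Q a b] the constant [W] controls. *)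
Lemma canonical_paths_bound pi p gam (G : {set Omega}) f :
    distribution_on pi -> stochastic p -> reversible pi p ->
    (forall eta eta', eta \in G -> eta' \in G ->
       is_path p eta eta' (gam eta eta') /\ stays_in G (gam eta eta')) ->
  \sum_(eta in G) \sum_(eta' in G) pi eta * pi eta' * (f eta - f eta') ^+ 2 <=
  W pi p gam G * \sum_x \sum_y Q pi p x y * (f x - f y) ^+ 2.
Proof.
move=> [pi0 _] [p0 _] pi_rev gam_path.
have Q0 a b : 0 <= Q pi p a b by rewrite mulr_ge0.
have W0 : 0 <= W pi p gam G by exact: bigmax_ge_id.
pose w a b eta eta' := if edge_in a b (gam eta eta')
  then (size (gam eta eta'))%:R * pi eta * pi eta' else 0.
have w0 a b eta eta' : 0 <= w a b eta eta'.
  by rewrite /w; case: ifP => // _; rewrite !mulr_ge0.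
have along_path eta eta' : eta \in G -> eta' \in G ->
    pi eta * pi eta' * (f eta - f eta') ^+ 2 <=
    \sum_(a in G) \sum_(b in G | Q pi p a b != 0)
       w a b eta eta' * (f a - f b) ^+ 2.
  move=> etaG eta'G; have [pi_eta|pi_eta] := eqVneq (pi eta) 0.
    rewrite pi_eta !mul0r; apply: sumr_ge0 => a _; apply: sumr_ge0 => b _.
    by rewrite mulr_ge0 ?sqr_ge0.
  have [] := gam_path _ _ etaG eta'G; rewrite /w.
  case: (gam eta eta') => // x s [xE <- path_s] sG; subst x.
  pose e a b := [&& edge_in a b (eta :: s), a \in G, b \in G & Q pi p a b != 0].
  have : path e eta s.
    rewrite path_all_zip; apply/allP => -[a b] /= ab_s.
    have := path_Q_neq0 pi_rev pi_eta path_s.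
    rewrite path_all_zip => /allP /(_ _ ab_s) /= Qab.
    rewrite /e /edge_in /= ab_s Qab andbT /=; have [a_s b_s] := mem_zip ab_s.
    by rewrite !sG // inE b_s orbT.
  move=> /(sqr_increment_path f) le_f.
  have := ler_wpM2l (mulr_ge0 (pi0 eta) (pi0 (last eta s))) le_f.
  move=> /le_trans; apply; rewrite mulrA mulr_sumr [leRHS]big_mkcond /=.
  rewrite le_eqVlt; apply/orP; left; apply/eqP; apply: eq_bigr => a _.
  rewrite mulr_sumr [LHS]big_mkcond; case: ifP => aG; last first.
    by rewrite big1 // => b _; rewrite /e aG andbF.
  rewrite [RHS]big_mkcond; apply: eq_bigr => b _; rewrite /e aG /=.
  by case: edge_in => /=; case: ifP => // _; rewrite ?mul0r //; ring.
apply: le_trans (_ : _ <= \sum_(eta in G) \sum_(eta' in G) \sum_(a in G)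
    \sum_(b in G | Q pi p a b != 0) w a b eta eta' * (f a - f b) ^+ 2) _.
  by apply: ler_sum => eta etaG; apply: ler_sum => eta' eta'G; exact: along_path.
under eq_bigr do rewrite exchange_big /=.
rewrite exchange_big mulr_sumr [leLHS]big_mkcond; apply: ler_sum => a _ /=.
case: ifP => [aG|_]; last first.
  apply: mulr_ge0 => //; apply: sumr_ge0 => b _.
  by rewrite mulr_ge0 ?sqr_ge0.
under eq_bigr do rewrite exchange_big /=.
rewrite exchange_big mulr_sumr [leLHS]big_mkcond; apply: ler_sum => b _ /=.
case: ifP => [/andP[bG Qab]|_]; last first.
  exact: mulr_ge0 W0 (mulr_ge0 (Q0 _ _) (sqr_ge0 _)).
under eq_bigr do rewrite -mulr_suml.
rewrite -mulr_suml mulrA ler_wpM2r ?sqr_ge0 //.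
have Qab_gt0 : 0 < Q pi p a b by rewrite lt_def Qab Q0.
apply: le_trans (edge_weight_le_W gam aG bG Qab_gt0).
by apply: ler_sum => eta _; rewrite big_mkcondr.
Qed.

End CanonicalPaths.

(** * The law of the chain at a fixed time *)

Section Law.
Context {R : realType} {Omega : finType}.
Context {d : measure_display} {S : measurableType d}.
Implicit Types (p : Omega -> Omega -> R).

Lemma measure_sum_fibers {I : finType} (mu : {measure set S -> \bar R})
    (Y : S -> I) (A : set S) : measurable A ->
    (forall y, measurable (Y @^-1` [set y])) ->
  mu A = (\sum_y mu (A `&` Y @^-1` [set y]))%E.
Proof.
move=> mA mY.
have {1}-> : A = \bigcup_(y in [set: I]) (A `&` Y @^-1` [set y]).
  by apply/seteqP; split=> [s As|s [y _ [As _]]] //; exists (Y s).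
rewrite measure_fin_bigcup; last 3 first.
- exact: finite_finset.
- by move=> y z _ _ [s [[_ <-] [_ <-]]].
- by move=> y _; exact: measurableI.
rewrite (fsbigE (index_enum I)) ?index_enum_uniq //.
- by apply: eq_bigl => y; rewrite in_setT.
- by move=> y _; rewrite mem_index_enum.
Qed.

Lemma history_measurable (X : nat -> S -> Omega) h n :
  (forall t y, measurable (X t @^-1` [set y])) -> measurable (history X h n).
Proof.
move=> mX; have -> : history X h n =
    \bigcap_(k in [set k | (k <= n)%N]) (X k @^-1` [set h k]).
  by apply/seteqP; split=> s hs k; exact: hs.
exact: bigcap_measurableType.
Qed.

(** The Markov property gives the weight of one more step only when the whole
    past is known, so the induction on the number [k] of further steps has to
    be over all histories; the first of these steps is split according to the
    state it reaches. *)
Lemma markov_history_future p (Pr : Omega -> probability S R) X x h m k y :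
    markov_chain p Pr X ->
  Pr x (history X h m `&` X (m + k)%N @^-1` [set y]) =
  (Pr x (history X h m) * (transition_iter p k (h m) y)%:E)%E.
Proof.
move=> [mX X0 Xmarkov]; have mhist h' n := history_measurable h' n mX.
elim: k h m => [|k IH] h m /=.
  rewrite addn0; case: eqP => [<-|hm_y].
    rewrite mule1; congr (Pr x _); apply/seteqP; split=> [s []|s hs] //.
    by split=> //; exact: hs.
  rewrite mule0 [X in Pr x X](_ : _ = set0) ?measure0 //.
  by apply/seteqP; split=> // s [hs /= Xy]; apply: hm_y; rewrite -(hs m).
rewrite (measure_sum_fibers _ (Y := X m.+1)) //; last first.
  by apply: measurableI; [exact: mhist|exact: mX].
have fiber z : Pr x (history X h m `&` X (m + k.+1)%N @^-1` [set y] `&`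
      X m.+1 @^-1` [set z]) =
    (Pr x (history X h m) * (p (h m) z * transition_iter p k z y)%:E)%E.
  pose h' i := if i == m.+1 then z else h i.
  have h'h i : (i <= m)%N -> h' i = h i by move=> im; rewrite /h' ltn_eqF.
  have h'm : h' m.+1 = z by rewrite /h' eqxx.
  have -> : history X h m `&` X (m + k.+1)%N @^-1` [set y] `&`
      X m.+1 @^-1` [set z] = history X h' m.+1 `&` X (m.+1 + k)%N @^-1` [set y].
    rewrite addnS -addSn; apply/seteqP; split=> s /=.
      case=> -[hs Xy] Xz; split=> // i; rewrite leq_eqVlt => /orP[/eqP ->|im].
        by rewrite h'm.
      by rewrite h'h // hs.
    case=> hs Xy; split; last by rewrite -h'm hs.
    by split=> // i im; rewrite -h'h // hs // leqW.
  rewrite IH Xmarkov h'm h'h // EFinM muleA; congr (Pr x _ * _ * _)%E.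
  by apply/seteqP; split=> s hs i im; [rewrite -h'h|rewrite h'h] => //; exact: hs.
apply: (etrans (eq_bigr _ (fun z _ => fiber z))).
have /fineK <- : Pr x (history X h m) \is a fin_num by exact: fin_num_measure.
under eq_bigr do rewrite -EFinM.
by rewrite sumEFin -EFinM mulr_sumr.
Qed.

Lemma law_of_state p (Pr : Omega -> probability S R) X x n y :
  markov_chain p Pr X -> Pr x (X n @^-1` [set y]) = (transition_iter p n x y)%:E.
Proof.
move=> hX; have [mX X0 _] := hX.
have start : history X (fun=> x) 0 = X 0%N @^-1` [set x].
  apply/seteqP; split=> [s hs|s sx k]; first exact: (hs 0%N).
  by rewrite leqn0 => /eqP ->.
have := markov_history_future x (fun=> x) 0 n y hX.
rewrite start X0 mul1e add0n /= => <-; apply/eqP; rewrite eq_le; apply/andP; split.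
  have never : Pr x (~` (X 0%N @^-1` [set x])) = 0%E.
    by rewrite probability_setC // X0 subee.
  rewrite setIC -[leRHS]adde0 -never.
  apply: (le_trans _ (measureU2 _ _ _)).
  - apply: le_measure; rewrite ?inE //.
      by apply: measurableU; [exact: measurableI|exact: measurableC].
    by move=> s Xy; case: (pselect (X 0%N s = x)); [left|right].
  - exact: measurableI.
  - exact: measurableC.
by apply: le_measure; rewrite ?inE //; exact: measurableI.
Qed.

Lemma law_of_set p (Pr : Omega -> probability S R) X x n (G : {set Omega}) :
    markov_chain p Pr X ->
  Pr x (X n @^-1` [set` G]) = (\sum_(y in G) transition_iter p n x y)%:E.
Proof.
move=> hX; have [mX _ _] := hX.
have mG : measurable (X n @^-1` [set` G]).
  rewrite (_ : _ @^-1` _ = \bigcup_(y in [set` G]) X n @^-1` [set y]).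
    by apply: fin_bigcup_measurable => [|y _]; [exact: finite_finset|exact: mX].
  by apply/seteqP; split=> [s Gs|s [y /= Gy /= ->]] //; exists (X n s).
rewrite (measure_sum_fibers _ mG (mX n)) -sumEFin [RHS]big_mkcond.
apply: eq_bigr => y _ /=; case: ifP => yG.
  rewrite -(law_of_state x n y hX); congr (Pr x _).
  by apply/seteqP; split=> [s []|s /= sy] //; rewrite sy.
rewrite [X in Pr x X](_ : _ = set0) ?measure0 //.
by apply/seteqP; split=> // s [/= + sy]; rewrite sy yG.
Qed.

End Law.

(** * From the variance to the variance on [G] *)

Section Comparison.
Context {R : realType} {Omega : finType}.
Implicit Types (pi f : Omega -> R) (p q : Omega -> Omega -> R).

(** Conditioning the kernel [q] to land in [G] costs a factor [1/alpha] on each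
    transition, and sends [pi] to a probability [mu] carried by [G] with
    [mu <= pi / alpha].  Measuring [f] from its [mu]-mean [c], the inequality
    [(f x - c)^2 <= 2 (f x - f y)^2 + 2 (f y - c)^2], with [y] the point of [G]
    reached from [x], leaves the displacement and the [mu]-variance. *)
Lemma Var_le_displacement_add_local pi q (G : {set Omega}) (alpha : R) f :
    distribution_on pi -> stochastic q -> invariant_measure pi q ->
    0 < alpha -> (forall x, alpha <= \sum_(y in G) q x y) ->
  Var pi f <= 2 / alpha * (\sum_x \sum_y pi x * q x y * (f x - f y) ^+ 2) +
    (alpha^-1) ^+ 2 *
      \sum_(x in G) \sum_(y in G) pi x * pi y * (f x - f y) ^+ 2.
Proof.
move=> pi_distr [q0 _] pi_inv alpha_gt0 hit; have [pi0 pi1] := pi_distr.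
pose h x := \sum_(y in G) q x y.
have h_gt0 x : 0 < h x by exact: lt_le_trans (hit x).
pose k x y := if y \in G then q x y / h x else 0.
have k0 x y : 0 <= k x y.
  by rewrite /k; case: ifP => // _; rewrite divr_ge0 // ltW.
have k1 x : \sum_y k x y = 1.
  by rewrite /k -big_mkcond -mulr_suml -/(h x) divff // gt_eqF.
have k_le x y : k x y <= alpha^-1 * q x y.
  rewrite /k; case: ifP => _; last by rewrite mulr_ge0 // invr_ge0 ltW.
  by rewrite mulrC; apply: ler_wpM2r => //; rewrite lef_pV2 ?posrE //; exact: hit.
pose mu y := \sum_x pi x * k x y.
have mu0 y : 0 <= mu y by apply: sumr_ge0 => x _; rewrite mulr_ge0.
have mu_distr : distribution_on mu.
  split=> //; rewrite /mu exchange_big -[RHS]pi1; apply: eq_bigr => x _ /=.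
  by rewrite -mulr_sumr k1 mulr1.
have mu_le y : mu y <= alpha^-1 * pi y.
  rewrite -pi_inv mulr_sumr; apply: ler_sum => x _.
  by rewrite [leRHS]mulrCA ler_wpM2l.
have mu_out y : y \notin G -> mu y = 0.
  by move=> /negPf yG; rewrite /mu big1 // => x _; rewrite /k yG mulr0.
pose c := mean mu f.
apply: (le_trans (Var_le_mean_sqr f c pi_distr)).
apply: le_trans (_ : _ <= 2 * (\sum_x \sum_y pi x * k x y * (f x - f y) ^+ 2) +
    2 * Var mu f) _.
  have -> : Var mu f = \sum_x \sum_y pi x * k x y * (f y - c) ^+ 2.
    rewrite exchange_big; apply: eq_bigr => y _ /=.
    by rewrite -mulr_suml.
  rewrite !mulr_sumr -big_split /=; apply: ler_sum => x _.
  have -> : pi x * (f x - c) ^+ 2 = \sum_y pi x * k x y * (f x - c) ^+ 2.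
    by rewrite -mulr_suml -mulr_sumr k1 mulr1.
  rewrite !mulr_sumr -big_split /=; apply: ler_sum => y _.
  have w0 : 0 <= pi x * k x y by rewrite mulr_ge0.
  rewrite -subr_ge0 [leRHS](_ : _ =
    pi x * k x y * (f x - f y - (f y - c)) ^+ 2); last by ring.
  by rewrite mulr_ge0 ?sqr_ge0.
rewrite Var_pairs //; apply: lerD.
  rewrite -mulrA ler_wpM2l // mulr_sumr; apply: ler_sum => x _.
  rewrite mulr_sumr; apply: ler_sum => y _.
  by rewrite [leRHS]mulrA ler_wpM2r ?sqr_ge0 // [leRHS]mulrCA ler_wpM2l.
rewrite mulr_sumr [leRHS]big_mkcond; apply: ler_sum => x _ /=.
case: ifPn => [xG|/mu_out mux]; last by rewrite big1 // => y _; rewrite mux !mul0r.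
rewrite mulr_sumr [leRHS]big_mkcond; apply: ler_sum => y _ /=.
case: ifPn => [yG|/mu_out muy]; last by rewrite muy mulr0 mul0r.
rewrite [leRHS]mulrA ler_wpM2r ?sqr_ge0 //.
rewrite [leRHS](_ : _ = alpha^-1 * pi x * (alpha^-1 * pi y)); last by ring.
exact: ler_pM.
Qed.

End Comparison.

(** * The Poincare inequality *)

Section Poincare.
Context {R : realType} {Omega : finType}.
Implicit Types (pi f : Omega -> R) (p : Omega -> Omega -> R).

Lemma dirichlet_form_ge0 pi p f : distribution_on pi -> stochastic p ->
  invariant_measure pi p -> 0 <= dirichlet_form pi p f.
Proof.
move=> [pi0 _] hp pi_inv; have [p0 _] := hp.
rewrite -(@pmulr_rge0 _ 2) // dirichlet_pairs //.
apply: sumr_ge0 => x _; apply: sumr_ge0 => y _.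
exact: mulr_ge0 (mulr_ge0 _ _) (sqr_ge0 _).
Qed.

Lemma poincare_hitting_set pi p (G : {set Omega}) T (alpha : R) gam f :
    distribution_on pi -> stochastic p -> invariant_measure pi p ->
    reversible pi p -> 0 < alpha ->
    (forall x, alpha <= \sum_(y in G) transition_iter p T x y) ->
    (forall eta eta', eta \in G -> eta' \in G ->
       is_path p eta eta' (gam eta eta') /\ stays_in G (gam eta eta')) ->
  Var pi f <= (4 / alpha * T%:R ^+ 2 + 2 / alpha ^+ 2 * W pi p gam G) *
    dirichlet_form pi p f.
Proof.
move=> pi_distr hp pi_inv pi_rev alpha_gt0 hit gam_path.
apply: le_trans (Var_le_displacement_add_local f pi_distr
  (stochastic_iter T hp) (invariant_iter T pi_inv) alpha_gt0 hit) _.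
have := mean_sqr_displacement f T pi_distr hp pi_inv.
have := canonical_paths_bound f pi_distr hp pi_rev gam_path.
rewrite -dirichlet_pairs //; set D := dirichlet_form pi p f.
set A := \sum_(x in G) _; set B := \sum_x _ => le_A le_B.
have a0 : 0 <= 2 / alpha by rewrite divr_ge0 // ltW.
apply: le_trans (lerD (ler_wpM2l a0 le_B) (ler_wpM2l (sqr_ge0 _) le_A)) _.
by rewrite le_eqVlt; apply/orP; left; apply/eqP; rewrite -exprVn; ring.
Qed.

Lemma p_min_gt0 p : 0 < p_min p.
Proof. by apply: lt_bigmin => // x _; exact: lt_bigmin. Qed.

Lemma p_min_le1 p : p_min p <= 1.
Proof. exact: bigmin_le_id. Qed.

(** An empty infimum is no exception: it makes [gap] infinite. *)
Lemma gap_inv_le pi p (C : R) : distribution_on pi -> 0 < C ->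
    (forall f, Var pi f <= C * dirichlet_form pi p f) ->
  ((gap pi p)^-1 <= C%:E)%E.
Proof.
move=> [pi0 _] C_gt0 poincare.
have gapC : ((C^-1)%:E <= gap pi p)%E.
  apply: le_ereal_inf_tmp => _ [f /= Var_neq0 <-]; rewrite lee_fin.
  have Var_gt0 : 0 < Var pi f.
    rewrite lt_def Var_neq0 /=; apply: sumr_ge0 => x _.
    by rewrite mulr_ge0 ?sqr_ge0.
  by rewrite ler_pdivlMr // ler_pdivrMl.
have gap0 : (0 <= gap pi p)%E.
  by apply: le_trans gapC; rewrite lee_fin invr_ge0 ltW.
by rewrite inve_ple ?inE ?lee_fin ?(ltW C_gt0) // inver gt_eqF.
Qed.

End Poincare.

Theorem theorem2p4 (R : realType) (Omega : finType)
  (p : Omega -> Omega -> R) (pi : Omega -> R)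
  (d : measure_display) (S : measurableType d)
  (Pr : Omega -> probability S R) (X : nat -> S -> Omega)
  (hp : stochastic p) (hpi : distribution_on pi)
  (hinv : invariant_measure pi p) (hrev : reversible pi p)
  (hX : markov_chain p Pr X)
  (G : {set Omega}) (T : nat) (alpha : R)
  (hT : (0 < T)%N) (halpha : 0 < alpha)
  (hG : forall x : Omega, (alpha%:E <= Pr x (X T @^-1` [set` G]))%E)
  (gam : Omega -> Omega -> seq Omega)
  (hgam : forall eta eta' : Omega, eta \in G -> eta' \in G ->
     is_path p eta eta' (gam eta eta') /\ stays_in G (gam eta eta')) :
  ((gap pi p)^-1 <=
   (6 / alpha * (T%:R ^+ 2 / p_min p + W pi p gam G / alpha))%:E)%E.
Proof.
have W0 : 0 <= W pi p gam G by exact: bigmax_ge_id.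
have T2_gt0 : 0 < T%:R ^+ 2 :> R by rewrite exprn_gt0 // ltr0n.
have W_alpha0 : 0 <= W pi p gam G / alpha by rewrite divr_ge0 // ltW.
have hit x : alpha <= \sum_(y in G) transition_iter p T x y.
  by rewrite -lee_fin -(law_of_set x T G hX).
apply: gap_inv_le => // [|f].
  by rewrite mulr_gt0 ?divr_gt0 // ltr_pwDl // divr_gt0 ?p_min_gt0.
apply: (le_trans (poincare_hitting_set f hpi hp hinv hrev halpha hit hgam)).
apply: ler_wpM2r; first exact: dirichlet_form_ge0.
have le_T : T%:R ^+ 2 <= T%:R ^+ 2 / p_min p.
  by rewrite ler_pdivlMr ?p_min_gt0 // ler_piMr ?p_min_le1 // ltW.
rewrite [leLHS](_ : _ =
  alpha^-1 * (4 * T%:R ^+ 2 + 2 * (W pi p gam G / alpha))); last first.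
  by rewrite -exprVn; ring.
rewrite [leRHS](_ : _ =
  alpha^-1 * (6 * (T%:R ^+ 2 / p_min p + W pi p gam G / alpha))); last by ring.
by apply: ler_wpM2l; [rewrite invr_ge0 ltW|lra].
Qed.
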